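(* Let $g,\sigma,\rho^\pm,h_\pm>0$, let $U^+:[0,h_+]\to\mathbb{R}$ and $U^-:[-h_-,0]\to\mathbb{R}$ be of class $C^{l_0}$ with $l_0\ge 6$ and with $(U^\pm)'\neq 0$ everywhere on their domains, and let $$a:=\min\{U^-([-h_-,0])\cup U^+([0,h_+])\},\qquad b:=\max\{U^-([-h_-,0])\cup U^+([0,h_+])\}.$$ Let $k\in\mathbb{R}\setminus\{0\}$ satisfy $$-g(\rho^+-\rho^-)+\sigma k^2\ge 0 .$$ Suppose $c=c_R+ic_I\in\mathbb{C}$ with $c_I>0$ is an unstable wave speed for the wave number $k$ with $\eta\neq 0$, i.e. there exist $\eta\in\mathbb{C}\setminus\{0\}$ and functions $v_2^+$ on $[0,h_+]$, $v_2^-$ on $[-h_-,0]$ solving the eigenvalue problem described in the context. Then $$\Big(c_R-\frac{a+b}{2}\Big)^2+c_I^2\le\Big(\frac{b-a}{2}\Big)^2 .$$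
   Context: The two-phase incompressible Euler interface problem (upper fluid of density $\rho^+$, lower fluid of density $\rho^-$, gravity $g$, surface tension $\sigma$, rigid lid $x_2=h_+$, rigid bottom $x_2=-h_-$) is linearized at the shear flows $(U^\pm(x_2),0)$ with flat interface $x_2=0$. Looking for solutions $(v_2^\pm(x_2),\eta,p^\pm(x_2))e^{ik(x_1-ct)}$ (with $v_2^\pm$ the vertical velocity and $\eta$ the interface perturbation) gives the following eigenvalue problem for $(v_2^\pm,\eta)$, with wave number $k$ and wave speed $c=c_R+ic_I\in\mathbb{C}$: (i) $-(v_2^\pm)''+\Big(k^2+\dfrac{(U^\pm)''}{U^\pm-c}\Big)v_2^\pm=0$ on $[0,h_+]$ for the sign $+$, and on $[-h_-,0]$ for the sign $-$; (ii) $v_2^+(h_+)=0$ and $v_2^-(-h_-)=0$; (iii) $ik\eta\,(U^\pm(0)-c)=v_2^\pm(0)$; (iv) $ik\eta\big(g(\rho^+-\rho^-)-\sigma k^2\big)=\rho^-(U^-)'(0)v_2^-(0)-\rho^+(U^+)'(0)v_2^+(0)+\rho^+(v_2^+)'(0)(U^+(0)-c)-\rho^-(v_2^-)'(0)(U^-(0)-c)$. *)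

(* Defs.v *)
From Stdlib Require Import Reals.
From Coquelicot Require Import Coquelicot.
Open Scope R_scope.

Definition segment (lo hi x : R) : Prop := lo <= x <= hi.

(* Coquelicot's [is_derive] with [locally x] restricted to [D]: on a
   nondegenerate segment this is the usual derivative at interior points and
   the one-sided derivative at the endpoints, so that values of [f] outside
   [D] are irrelevant. *)
Definition is_derive_on {V : NormedModule R_AbsRing}
    (D : R -> Prop) (f : R -> V) (x : R) (l : V) : Prop :=
  filterdiff f (within D (locally x)) (fun y : R => scal y l).

Definition ex_derive_on {V : NormedModule R_AbsRing}
    (D : R -> Prop) (f : R -> V) (x : R) : Prop :=
  exists l : V, is_derive_on D f x l.

(* Meaningful at [x] only when [ex_derive_on D f x] and [x] is a
   non-isolated point of [D], in which case the derivative is unique. *)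
Definition Derive_on {V : CompleteNormedModule R_AbsRing}
    (D : R -> Prop) (f : R -> V) (x : R) : V :=
  iota (fun l : V => is_derive_on D f x l).

Fixpoint Derive_n_on {V : CompleteNormedModule R_AbsRing}
    (D : R -> Prop) (f : R -> V) (n : nat) : R -> V :=
  match n with
  | O => f
  | S m => Derive_on D (Derive_n_on D f m)
  end.

Definition derivable_n_on {V : CompleteNormedModule R_AbsRing}
    (D : R -> Prop) (n : nat) (f : R -> V) : Prop :=
  forall m : nat, (m < n)%nat ->
  forall x : R, D x -> ex_derive_on D (Derive_n_on D f m) x.

Definition class_C_on {V : CompleteNormedModule R_AbsRing}
    (D : R -> Prop) (n : nat) (f : R -> V) : Prop :=
  derivable_n_on D n f /\ continuous_on D (Derive_n_on D f n).

Definition dR (D : R -> Prop) (n : nat) (f : R -> R) : R -> R :=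
  @Derive_n_on R_CompleteNormedModule D f n.

(* [C] is seen here as a normed space over the reals. *)
Definition dC (D : R -> Prop) (n : nat) (f : R -> C) : R -> C :=
  @Derive_n_on C_R_CompleteNormedModule D f n.

(* The Rayleigh equation in one fluid layer. *)
Definition rayleigh_on (D : R -> Prop) (U : R -> R) (k : R) (c : C)
    (v : R -> C) : Prop :=
  @derivable_n_on C_R_CompleteNormedModule D 2 v /\
  forall x : R, D x ->
    (- dC D 2 v x + (RtoC (k ^ 2) + dR D 2 U x / (U x - c)) * v x = 0)%C.

(* [(vp, eta, vm)] solves the linearized interface eigenvalue problem at the
   shear flow [(Up, Um)] for the wave number [k] and the wave speed [c]. *)
Record interface_mode (g sigma rhop rhom hp hm : R) (Up Um : R -> R)
    (k : R) (c : C) (eta : C) (vp vm : R -> C) : Prop := {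
  rayleigh_upper : rayleigh_on (segment 0 hp) Up k c vp;
  rayleigh_lower : rayleigh_on (segment (- hm) 0) Um k c vm;
  rigid_lid : vp hp = RtoC 0;
  rigid_bottom : vm (- hm) = RtoC 0;
  kinematic_upper : (Ci * k * eta * (Up 0%R - c) = vp 0%R)%C;
  kinematic_lower : (Ci * k * eta * (Um 0%R - c) = vm 0%R)%C;
  dynamic :
    (Ci * k * eta * RtoC (g * (rhop - rhom) - sigma * k ^ 2)%R =
       rhom * dR (segment (- hm) 0) 1 Um 0%R * vm 0%R
       - rhop * dR (segment 0 hp) 1 Up 0%R * vp 0%R
       + rhop * dC (segment 0 hp) 1 vp 0%R * (Up 0%R - c)
       - rhom * dC (segment (- hm) 0) 1 vm 0%R * (Um 0%R - c))%C
}.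

Definition velocity_range (hp hm : R) (Up Um : R -> R) (u : R) : Prop :=
  (exists x : R, segment (- hm) 0 x /\ Um x = u) \/
  (exists x : R, segment 0 hp x /\ Up x = u).

Definition is_minimum (S : R -> Prop) (m : R) : Prop :=
  S m /\ forall u : R, S u -> m <= u.

Definition is_maximum (S : R -> Prop) (m : R) : Prop :=
  S m /\ forall u : R, S u -> u <= m.

(* Main.v *)
(* Howard's semicircle argument. In each layer put F = v / (U - c) and
   W = v' (U - c) - U' v = (U - c)^2 F'. The Rayleigh equation says
   W' = k^2 (U - c)^2 F, so that Z = W conj(F) satisfies
   Z' = (U - c)^2 Q with Q = k^2 |F|^2 + |F'|^2 >= 0. For
   s = (2 c_R - a - b) / (2 c_I) the real function H = Re Z - s Im Z has
   H' = ((U - a)(U - b) - m) Q, where m = c_R^2 + c_I^2 - (a + b) c_R + a b is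
   positive exactly when c lies outside the closed disc. Then H decreases in
   each layer, and since it vanishes on the rigid walls, H^+(0) > 0 >= H^-(0).
   But the interface conditions give
   rho^+ Z^+(0) - rho^- Z^-(0) = k^2 |eta|^2 (g (rho^+ - rho^-) - sigma k^2),
   which is a nonpositive real number. *)
Require Import Defs.
From Stdlib Require Import Reals.
From Coquelicot Require Import Coquelicot.
From Stdlib Require Import Lra Lia.
Open Scope R_scope.

Set Bullet Behavior "Strict Subproofs".

(** * Derivatives relative to a segment *)

Lemma is_derive_on_approx (D : R -> Prop) (f : R -> R) (x l : R) :
  @is_derive_on R_NormedModule D f x l ->
  forall eps : R, 0 < eps -> exists d : R, 0 < d /\
    forall y : R, D y -> Rabs (y - x) < d ->
    Rabs (f y - f x - (y - x) * l) <= eps * Rabs (y - x).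
Proof.
  intros [_ Hf] eps Heps.
  assert (Hlim : is_filter_lim (within D (locally x)) x).
  { intros P HP. apply (filter_imp (F := locally x) P); [auto | exact HP]. }
  destruct (Hf x Hlim (mkposreal eps Heps)) as [d Hd].
  exists d. split; [apply cond_pos |].
  intros y HDy Hy. exact (Hd y Hy HDy).
Qed.

(** Near any point of a nondegenerate segment there are other points of it, at least on one side,
    and two linear approximations with different slopes conflict there. This is what makes the
    [iota] in [Derive_on] meaningful. *)
Lemma is_derive_on_segment_unique (lo hi : R) (f : R -> R) (x l1 l2 : R) :
  lo < hi -> segment lo hi x ->
  @is_derive_on R_NormedModule (segment lo hi) f x l1 ->
  @is_derive_on R_NormedModule (segment lo hi) f x l2 -> l1 = l2.
Proof.
  intros Hlh [Hlx Hxh] H1 H2.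
  destruct (Req_dec l1 l2) as [|Hne]; [assumption | exfalso].
  (* Two errors of one third each cannot add up to the full gap [Rabs (l1 - l2)]. *)
  assert (He : 0 < Rabs (l1 - l2) / 3).
  { apply Rdiv_lt_0_compat; [apply Rabs_pos_lt; lra | lra]. }
  destruct (is_derive_on_approx _ _ _ _ H1 _ He) as [d1 [Hd1 A1]].
  destruct (is_derive_on_approx _ _ _ _ H2 _ He) as [d2 [Hd2 A2]].
  (* As [d] is at most half the length of the segment, [x + d] or [x - d] stays inside. *)
  set (d := Rmin (Rmin d1 d2) (hi - lo) / 2).
  assert (Hd : 0 < d /\ d < d1 /\ d < d2 /\ 2 * d <= hi - lo).
  { unfold d. unfold Rmin. repeat destruct Rle_dec; lra. }
  assert (Hy : exists y, segment lo hi y /\ Rabs (y - x) = d).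
  { destruct (Rle_dec (x + d) hi).
    - exists (x + d). split; [unfold segment; lra |].
      rewrite Rabs_pos_eq; lra.
    - exists (x - d). split; [unfold segment; lra |].
      rewrite Rabs_left; lra. }
  destruct Hy as [y [HDy Hy]].
  specialize (A1 y HDy ltac:(lra)). specialize (A2 y HDy ltac:(lra)).
  rewrite Hy in A1, A2.
  assert (A3 : Rabs ((y - x) * (l1 - l2)) <= Rabs (l1 - l2) / 3 * d + Rabs (l1 - l2) / 3 * d).
  { replace ((y - x) * (l1 - l2))
      with ((f y - f x - (y - x) * l2) + - (f y - f x - (y - x) * l1)) by ring.
    eapply Rle_trans; [apply Rabs_triang |]. rewrite Rabs_Ropp. lra. }
  rewrite Rabs_mult, Hy in A3. nra.
Qed.

Lemma is_derive_on_Re (D : R -> Prop) (f : R -> C) (x : R) (l : C) :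
  @is_derive_on C_R_NormedModule D f x l ->
  @is_derive_on R_NormedModule D (fun y => Re (f y)) x (Re l).
Proof.
  intros Hf.
  exact (filterdiff_comp (U := R_NormedModule)
    (V := prod_NormedModule R_AbsRing R_NormedModule R_NormedModule)
    (W := R_NormedModule) f fst (fun y => scal y l) fst Hf
    (filterdiff_linear _ is_linear_fst)).
Qed.

Lemma is_derive_on_Im (D : R -> Prop) (f : R -> C) (x : R) (l : C) :
  @is_derive_on C_R_NormedModule D f x l ->
  @is_derive_on R_NormedModule D (fun y => Im (f y)) x (Im l).
Proof.
  intros Hf.
  exact (filterdiff_comp (U := R_NormedModule)
    (V := prod_NormedModule R_AbsRing R_NormedModule R_NormedModule)
    (W := R_NormedModule) f snd (fun y => scal y l) snd Hf
    (filterdiff_linear _ is_linear_snd)).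
Qed.

Lemma dR_correct (lo hi : R) (n m : nat) (f : R -> R) (x : R) :
  lo < hi -> @derivable_n_on R_CompleteNormedModule (segment lo hi) n f ->
  (m < n)%nat -> segment lo hi x ->
  @is_derive_on R_NormedModule (segment lo hi) (dR (segment lo hi) m f) x
    (dR (segment lo hi) (S m) f x).
Proof.
  intros Hlh Hf Hm Hx. destruct (Hf m Hm x Hx) as [l Hl].
  refine (iota_correct (V := R_CompleteNormedModule) _ _).
  exists l. split; [exact Hl |].
  intros l' Hl'. exact (is_derive_on_segment_unique _ _ _ _ _ _ Hlh Hx Hl Hl').
Qed.

(** Uniqueness of the complex derivative is inherited from its real and imaginary parts. *)
Lemma dC_correct (lo hi : R) (n m : nat) (f : R -> C) (x : R) :
  lo < hi -> @derivable_n_on C_R_CompleteNormedModule (segment lo hi) n f ->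
  (m < n)%nat -> segment lo hi x ->
  @is_derive_on C_R_NormedModule (segment lo hi) (dC (segment lo hi) m f) x
    (dC (segment lo hi) (S m) f x).
Proof.
  intros Hlh Hf Hm Hx. destruct (Hf m Hm x Hx) as [l Hl].
  refine (iota_correct (V := C_R_CompleteNormedModule) _ _).
  exists l. split; [exact Hl |].
  intros l' Hl'. apply injective_projections.
  - exact (is_derive_on_segment_unique _ _ _ _ _ _ Hlh Hx
      (is_derive_on_Re _ _ _ _ Hl) (is_derive_on_Re _ _ _ _ Hl')).
  - exact (is_derive_on_segment_unique _ _ _ _ _ _ Hlh Hx
      (is_derive_on_Im _ _ _ _ Hl) (is_derive_on_Im _ _ _ _ Hl')).
Qed.

(* Extending by the tangent lines at the endpoints turns one-sided
   derivatives into two-sided ones. *)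
Lemma is_derive_on_extend (lo hi : R) (f df : R -> R) :
  lo < hi ->
  (forall x, segment lo hi x ->
     @is_derive_on R_NormedModule (segment lo hi) f x (df x)) ->
  exists g : R -> R, (forall x, segment lo hi x -> g x = f x) /\
    forall x, segment lo hi x -> is_derive g x (df x).
Proof.
  intros Hlh Hf.
  set (cl := fun y => Rmax lo (Rmin hi y)).
  set (g := fun y => f (cl y) + df (cl y) * (y - cl y)).
  assert (Hin : forall y, segment lo hi y -> cl y = y).
  { intros y [? ?]. unfold cl. rewrite (Rmin_right hi y) by lra.
    apply Rmax_right; lra. }
  assert (Hgf : forall y, segment lo hi y -> g y = f y).
  { intros y Hy. unfold g. rewrite (Hin y Hy). ring. }
  exists g. split; [exact Hgf |].
  intros x Hx. apply is_derive_Reals. intros eps Heps.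
  destruct (is_derive_on_approx _ _ _ _ (Hf x Hx) (eps / 2)) as [d [Hd A]]; [lra |].
  pose proof Hx as [Hlx Hxh].
  (* Within distance [d'] of [x], the segment can be left only past an endpoint equal to [x], and
     there [g] is exactly affine. The value [d] in the [else] branches is a dummy that adds no
     constraint. *)
  set (d' := Rmin d (Rmin (if Rlt_dec lo x then x - lo else d)
                          (if Rlt_dec x hi then hi - x else d))).
  assert (Hd' : 0 < d' /\ d' <= d /\ (lo < x -> d' <= x - lo) /\ (x < hi -> d' <= hi - x)).
  { unfold d', Rmin. destruct (Rlt_dec lo x), (Rlt_dec x hi);
      repeat destruct Rle_dec; repeat split; intros; lra. }
  clearbody d'. destruct Hd' as [Hd'0 [Hd'd [Hdl Hdr]]].
  exists (mkposreal d' Hd'0). intros h Hh Hhd. simpl in Hhd.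
  assert (B : Rabs (g (x + h) - g x - h * df x) <= eps / 2 * Rabs h).
  { assert (P : 0 <= eps / 2 * Rabs h) by (apply Rmult_le_pos; [lra | apply Rabs_pos]).
    pose proof (Rabs_def2 _ _ Hhd) as [Hh1 Hh2].
    rewrite (Hgf x Hx).
    destruct (Rlt_dec (x + h) lo) as [Hl | Hl].
    - assert (x = lo) by (destruct (Rlt_dec lo x) as [Hy | ]; [specialize (Hdl Hy) |]; lra).
      assert (cl (x + h) = lo) as E.
      { unfold cl. rewrite (Rmin_right hi) by lra. apply Rmax_left; lra. }
      unfold g. rewrite E. subst x.
      replace (f lo + df lo * (lo + h - lo) - f lo - h * df lo) with 0 by ring.
      rewrite Rabs_R0. exact P.
    - destruct (Rlt_dec hi (x + h)) as [Hr | Hr].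
      + assert (x = hi) by (destruct (Rlt_dec x hi) as [Hy | ]; [specialize (Hdr Hy) |]; lra).
        assert (cl (x + h) = hi) as E.
        { unfold cl. rewrite (Rmin_left hi) by lra. apply Rmax_right; lra. }
        unfold g. rewrite E. subst x.
        replace (f hi + df hi * (hi + h - hi) - f hi - h * df hi) with 0 by ring.
        rewrite Rabs_R0. exact P.
      + assert (Hs : segment lo hi (x + h)) by (unfold segment; lra).
        rewrite (Hgf _ Hs). specialize (A _ Hs).
        replace (x + h - x) with h in A by ring. apply A. lra. }
  replace ((g (x + h) - g x) / h - df x) with ((g (x + h) - g x - h * df x) / h)
    by (field; exact Hh).
  rewrite Rabs_div by exact Hh.
  pose proof (Rabs_pos_lt h Hh) as Hp.
  apply Rmult_lt_reg_r with (Rabs h); [exact Hp |].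
  unfold Rdiv. rewrite Rmult_assoc, Rinv_l by lra. nra.
Qed.

(** * Monotonicity on a segment and decay of the flux in one layer *)

(** A negative derivative at [lo] forces a strict drop just to the right of [lo], and the mean value
    theorem prevents any later recovery. *)
Lemma nonincreasing_segment (lo hi : R) (f df : R -> R) :
  lo < hi ->
  (forall x, segment lo hi x -> is_derive f x (df x)) ->
  (forall x, segment lo hi x -> df x <= 0) ->
  f hi <= f lo /\ (df lo < 0 -> f hi < f lo).
Proof.
  intros Hlh Hf Hdf.
  assert (Hmono : forall y, segment lo hi y -> f hi <= f y).
  { intros y [Hly Hyh].
    destruct (MVT_gen f y hi df) as [z [Hz E]].
    - rewrite Rmin_left, Rmax_right by lra. intros z Hz. apply Hf. unfold segment; lra.
    - rewrite Rmin_left, Rmax_right by lra. intros z Hz.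
      apply continuity_pt_filterlim, (ex_derive_continuous f z).
      exists (df z). apply Hf. unfold segment; lra.
    - rewrite Rmin_left, Rmax_right in Hz by lra.
      assert (df z <= 0) by (apply Hdf; unfold segment; lra). nra. }
  split; [apply Hmono; unfold segment; lra |].
  intros Hneg.
  assert (Hlo : is_derive f lo (df lo)) by (apply Hf; unfold segment; lra).
  apply is_derive_Reals in Hlo.
  destruct (Hlo (- df lo)) as [d Hd]; [lra |].
  set (h := Rmin d (hi - lo) / 2).
  pose proof (cond_pos d).
  assert (Hh : 0 < h /\ h < d /\ h <= hi - lo).
  { unfold h, Rmin. destruct Rle_dec; lra. }
  assert (A : Rabs ((f (lo + h) - f lo) / h - df lo) < - df lo).
  { apply Hd; [lra |]. rewrite Rabs_pos_eq; lra. }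
  apply Rabs_def2 in A.
  assert (E : f (lo + h) - f lo = (f (lo + h) - f lo) / h * h) by (field; lra).
  assert (f (lo + h) < f lo) by nra.
  assert (f hi <= f (lo + h)) by (apply Hmono; unfold segment; lra). lra.
Qed.

(* The eta-expanded form is the one produced by [auto_derive]. *)
Lemma Derive_eta_unique (f : R -> R) (x l : R) :
  is_derive f x l -> Derive (fun y : R => f y) x = l.
Proof. exact (is_derive_unique f x l). Qed.

(* Here [v = p + i q], [W = w1 + i w2] and [F = f1 + i f2]. *)
Lemma real_rayleigh_flux_decay (lo hi k cr ci a b : R)
    (u u1 u2 p p1 p2 q q1 q2 : R -> R) :
  lo < hi -> k <> 0 -> 0 < ci ->
  (forall x, segment lo hi x ->
     is_derive u x (u1 x) /\ is_derive u1 x (u2 x) /\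
     is_derive p x (p1 x) /\ is_derive p1 x (p2 x) /\
     is_derive q x (q1 x) /\ is_derive q1 x (q2 x)) ->
  (forall x, segment lo hi x -> a <= u x <= b) ->
  (forall x, segment lo hi x ->
     (u x - cr) * p2 x + ci * q2 x =
       (k ^ 2 * (u x - cr) + u2 x) * p x + k ^ 2 * ci * q x /\
     (u x - cr) * q2 x - ci * p2 x =
       (k ^ 2 * (u x - cr) + u2 x) * q x - k ^ 2 * ci * p x) ->
  0 < cr ^ 2 + ci ^ 2 - (a + b) * cr + a * b ->
  let w1 := fun x => p1 x * (u x - cr) + q1 x * ci - u1 x * p x in
  let w2 := fun x => q1 x * (u x - cr) - p1 x * ci - u1 x * q x in
  let f1 := fun x => (p x * (u x - cr) - q x * ci) / ((u x - cr) ^ 2 + ci ^ 2) in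
  let f2 := fun x => (q x * (u x - cr) + p x * ci) / ((u x - cr) ^ 2 + ci ^ 2) in
  let H := fun x => (w1 x * f1 x + w2 x * f2 x)
    - (2 * cr - a - b) / (2 * ci) * (w2 x * f1 x - w1 x * f2 x) in
  H hi <= H lo /\ (0 < p lo ^ 2 + q lo ^ 2 -> H hi < H lo).
Proof.
  intros Hlh Hk Hci Hder Hu Hray Hm w1 w2 f1 f2 H.
  set (m := cr ^ 2 + ci ^ 2 - (a + b) * cr + a * b) in *.
  set (N := fun x => (u x - cr) ^ 2 + ci ^ 2).
  (* Here [N] is |U - c|^2, and the two terms of [Q] are k^2 |F|^2 and |F'|^2, the latter written
     through F' = W / (U - c)^2. *)
  set (Q := fun x => k ^ 2 * (p x ^ 2 + q x ^ 2) / N x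
                     + (w1 x ^ 2 + w2 x ^ 2) / N x ^ 2).
  assert (Hsq : forall y z : R, 0 <= y ^ 2 + z ^ 2).
  { intros y z. pose proof (pow2_ge_0 y). pose proof (pow2_ge_0 z). lra. }
  assert (HN : forall x, 0 < N x).
  { intros x. unfold N. pose proof (pow2_ge_0 (u x - cr)).
    pose proof (pow2_gt_0 ci). lra. }
  assert (HQ : forall x, 0 <= Q x).
  { intros x. unfold Q. pose proof (HN x).
    apply Rplus_le_le_0_compat; apply Rdiv_le_0_compat.
    - apply Rmult_le_pos; [apply pow2_ge_0 | apply Hsq].
    - assumption.
    - apply Hsq.
    - apply pow_lt; assumption. }
  (* The slope s satisfies [2 * s * ci = 2 * cr - a - b], which turns Re (U - c)^2 - s Im (U - c)^2
     into (U - a)(U - b) - m. *)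
  set (dH := fun x => ((u x - a) * (u x - b) - m) * Q x).
  assert (HdH : forall x, segment lo hi x -> is_derive H x (dH x)).
  { intros x Hx. destruct (Hder x Hx) as (D1 & D2 & D3 & D4 & D5 & D6).
    destruct (Hray x Hx) as [R1 R2]. pose proof (HN x) as HNx.
    (* Real and imaginary parts of W' = k^2 (U - c) v, then of F' = W conj(U - c)^2 / N^2. *)
    set (dw1 := k ^ 2 * ((u x - cr) * p x + ci * q x)).
    set (dw2 := k ^ 2 * ((u x - cr) * q x - ci * p x)).
    set (df1 := (w1 x * ((u x - cr) ^ 2 - ci ^ 2) - w2 x * (2 * (u x - cr) * ci)) / N x ^ 2).
    set (df2 := (w2 x * ((u x - cr) ^ 2 - ci ^ 2) + w1 x * (2 * (u x - cr) * ci)) / N x ^ 2).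
    assert (W1 : is_derive w1 x dw1).
    { unfold w1. auto_derive.
      - repeat split; eexists; eassumption.
      - rewrite (Derive_eta_unique _ _ _ D1), (Derive_eta_unique _ _ _ D2),
          (Derive_eta_unique _ _ _ D3), (Derive_eta_unique _ _ _ D4),
          (Derive_eta_unique _ _ _ D6). unfold dw1. lra. }
    assert (W2 : is_derive w2 x dw2).
    { unfold w2. auto_derive.
      - repeat split; eexists; eassumption.
      - rewrite (Derive_eta_unique _ _ _ D1), (Derive_eta_unique _ _ _ D2),
          (Derive_eta_unique _ _ _ D4), (Derive_eta_unique _ _ _ D5),
          (Derive_eta_unique _ _ _ D6). unfold dw2. lra. }
    unfold N in HNx.
    assert (F1 : is_derive f1 x df1).
    { unfold f1. auto_derive.
      - repeat split; try (eexists; eassumption). simpl in HNx; lra.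
      - rewrite (Derive_eta_unique _ _ _ D1), (Derive_eta_unique _ _ _ D3),
          (Derive_eta_unique _ _ _ D5).
        unfold df1, N, w1, w2. field. simpl in HNx; lra. }
    assert (F2 : is_derive f2 x df2).
    { unfold f2. auto_derive.
      - repeat split; try (eexists; eassumption). simpl in HNx; lra.
      - rewrite (Derive_eta_unique _ _ _ D1), (Derive_eta_unique _ _ _ D3),
          (Derive_eta_unique _ _ _ D5).
        unfold df2, N, w1, w2. field. simpl in HNx; lra. }
    replace (dH x) with
      (dw1 * f1 x + w1 x * df1 + (dw2 * f2 x + w2 x * df2)
       - (2 * cr - a - b) / (2 * ci) *
         (dw2 * f1 x + w2 x * df1 - (dw1 * f2 x + w1 x * df2))).
    { unfold H. clearbody w1 w2 f1 f2 dw1 dw2 df1 df2. auto_derive.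
      - repeat split; eexists; eassumption.
      - rewrite (Derive_eta_unique _ _ _ W1), (Derive_eta_unique _ _ _ W2),
          (Derive_eta_unique _ _ _ F1), (Derive_eta_unique _ _ _ F2). ring. }
    unfold dH, m, Q, dw1, dw2, df1, df2, f1, f2.
    (* From here the identity is algebraic and holds for arbitrary values of W. *)
    generalize (w1 x) (w2 x). intros y1 y2.
    unfold N. simpl. field. simpl in HNx; lra. }
  assert (Hsign : forall x, segment lo hi x -> dH x <= - m * Q x).
  { intros x Hx. specialize (Hu x Hx). specialize (HQ x). unfold dH.
    assert ((u x - a) * (u x - b) <= 0) by nra. nra. }
  destruct (nonincreasing_segment lo hi H dH Hlh HdH) as [C1 C2].
  { intros x Hx. specialize (Hsign x Hx). specialize (HQ x). nra. }
  split; [exact C1 |]. intros Hpq. apply C2.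
  assert (Hlo : segment lo hi lo) by (unfold segment; lra).
  specialize (Hsign lo Hlo).
  (* Strictness comes from the term k^2 |F|^2, positive at [lo] because v does not vanish there. *)
  assert (0 < Q lo).
  { unfold Q. pose proof (HN lo) as HNl.
    apply Rplus_lt_le_0_compat.
    - apply Rdiv_lt_0_compat; [| exact HNl].
      apply Rmult_lt_0_compat; [apply pow2_gt_0; exact Hk | exact Hpq].
    - apply Rdiv_le_0_compat; [apply Hsq | apply pow_lt, HNl]. }
  nra.
Qed.

(* The quantity Z = W conj(F). *)
Definition rayleigh_flux (D : R -> Prop) (U : R -> R) (c : C) (v : R -> C)
    (x : R) : C :=
  ((dC D 1 v x * (U x - c) - dR D 1 U x * v x) * Cconj (v x / (U x - c)))%C.

(** Reduces to the real statement: U, U' and the real and imaginary parts of v and v' are replaced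
    by extensions with two-sided derivatives, which agree with them on the segment. *)
Lemma rayleigh_flux_decay (lo hi : R) (U : R -> R) (k a b : R) (c : C)
    (v : R -> C) (n : nat) :
  lo < hi -> k <> 0 -> 0 < Im c -> (2 <= n)%nat ->
  @derivable_n_on R_CompleteNormedModule (segment lo hi) n U ->
  rayleigh_on (segment lo hi) U k c v ->
  (forall x, segment lo hi x -> a <= U x <= b) ->
  0 < Re c ^ 2 + Im c ^ 2 - (a + b) * Re c + a * b ->
  let H := fun x => Re (rayleigh_flux (segment lo hi) U c v x)
    - (2 * Re c - a - b) / (2 * Im c) * Im (rayleigh_flux (segment lo hi) U c v x) in
  H hi <= H lo /\ (v lo <> 0%C -> H hi < H lo).
Proof.
  intros Hlh Hk Hc Hn HU [Hv Hray] Hab Hm H.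
  set (D := segment lo hi) in *.
  assert (HU0 := fun x => dR_correct lo hi n 0 U x Hlh HU ltac:(lia)).
  assert (HU1 := fun x => dR_correct lo hi n 1 U x Hlh HU ltac:(lia)).
  assert (Hv0 := fun x => dC_correct lo hi 2 0 v x Hlh Hv ltac:(lia)).
  assert (Hv1 := fun x => dC_correct lo hi 2 1 v x Hlh Hv ltac:(lia)).
  fold D in HU0, HU1, Hv0, Hv1.
  destruct (is_derive_on_extend lo hi _ _ Hlh HU0) as (u & Eu & Du).
  destruct (is_derive_on_extend lo hi _ _ Hlh HU1) as (u1 & Eu1 & Du1).
  destruct (is_derive_on_extend lo hi _ _ Hlh
    (fun x Hx => is_derive_on_Re _ _ _ _ (Hv0 x Hx))) as (p & Ep & Dp).
  destruct (is_derive_on_extend lo hi _ _ Hlh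
    (fun x Hx => is_derive_on_Re _ _ _ _ (Hv1 x Hx))) as (p1 & Ep1 & Dp1).
  destruct (is_derive_on_extend lo hi _ _ Hlh
    (fun x Hx => is_derive_on_Im _ _ _ _ (Hv0 x Hx))) as (q & Eq & Dq).
  destruct (is_derive_on_extend lo hi _ _ Hlh
    (fun x Hx => is_derive_on_Im _ _ _ _ (Hv1 x Hx))) as (q1 & Eq1 & Dq1).
  change (dR D 0 U) with U in Eu. change (dC D 0 v) with v in Ep, Eq.
  fold D in Eu, Eu1, Ep, Ep1, Eq, Eq1, Du, Du1, Dp, Dp1, Dq, Dq1.
  assert (Hne : forall x, (U x - c)%C <> 0%C).
  { intros x E. apply (f_equal Im) in E. simpl in E. unfold Im in Hc. lra. }
  destruct (real_rayleigh_flux_decay lo hi k (Re c) (Im c) a b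
    u u1 (dR D 2 U) p p1 (fun x => Re (dC D 2 v x)) q q1 (fun x => Im (dC D 2 v x)))
    as [C1 C2]; try assumption.
  - intros x Hx. fold D in Hx.
    rewrite (Eu1 x Hx), (Ep1 x Hx), (Eq1 x Hx). exact (conj (Du x Hx)
      (conj (Du1 x Hx) (conj (Dp x Hx) (conj (Dp1 x Hx) (conj (Dq x Hx) (Dq1 x Hx)))))).
  - intros x Hx. rewrite (Eu x Hx). apply Hab, Hx.
  - intros x Hx. fold D in Hx. rewrite (Eu x Hx), (Ep x Hx), (Eq x Hx).
    (* Clearing the denominator U - c makes the real and imaginary parts of the Rayleigh equation
       polynomial. *)
    assert (R1 : ((U x - c) * dC D 2 v x
                  = (RtoC (k ^ 2) * (U x - c) + dR D 2 U x) * v x)%C).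
    { replace ((U x - c) * dC D 2 v x)%C with
        ((RtoC (k ^ 2) * (U x - c) + dR D 2 U x) * v x - (U x - c) *
         (- dC D 2 v x + (RtoC (k ^ 2) + dR D 2 U x / (U x - c)) * v x))%C
        by (field; apply Hne).
      rewrite (Hray x Hx). ring. }
    pose proof (f_equal Re R1) as R2. pose proof (f_equal Im R1) as R3.
    revert R2 R3. destruct (v x), (dC D 2 v x), c. simpl. intros. split; lra.
  - assert (EH : forall x, D x -> H x =
      (p1 x * (u x - Re c) + q1 x * Im c - u1 x * p x) *
      ((p x * (u x - Re c) - q x * Im c) / ((u x - Re c) ^ 2 + Im c ^ 2)) +
      (q1 x * (u x - Re c) - p1 x * Im c - u1 x * q x) *
      ((q x * (u x - Re c) + p x * Im c) / ((u x - Re c) ^ 2 + Im c ^ 2)) -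
      (2 * Re c - a - b) / (2 * Im c) *
      ((q1 x * (u x - Re c) - p1 x * Im c - u1 x * q x) *
       ((p x * (u x - Re c) - q x * Im c) / ((u x - Re c) ^ 2 + Im c ^ 2)) -
       (p1 x * (u x - Re c) + q1 x * Im c - u1 x * p x) *
       ((q x * (u x - Re c) + p x * Im c) / ((u x - Re c) ^ 2 + Im c ^ 2)))).
    { intros x Hx. unfold H, rayleigh_flux.
      rewrite (Eu x Hx), (Eu1 x Hx), (Ep x Hx), (Ep1 x Hx), (Eq x Hx), (Eq1 x Hx).
      generalize (dC D 1 v x) (dR D 1 U x) (v x) (U x).
      destruct c as [cr ci]. intros [y1 y2] t [z1 z2] r.
      unfold Re, Im in Hc |- *. simpl in Hc |- *. field.
      pose proof (pow2_ge_0 (r - cr)). split; nra. }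
    assert (Dlo : D lo) by (unfold D, segment; lra).
    assert (Dhi : D hi) by (unfold D, segment; lra).
    rewrite (EH lo Dlo), (EH hi Dhi). split; [exact C1 |].
    intros Hv_lo. apply C2. rewrite (Ep lo Dlo), (Eq lo Dlo).
    revert Hv_lo. destruct (v lo) as [z1 z2]. simpl. intros Hz.
    destruct (Req_dec z1 0) as [-> |]; [destruct (Req_dec z2 0) as [-> |] |].
    + destruct Hz. reflexivity.
    + nra.
    + nra.
Qed.

(** * Matching the two layers at the interface *)

Theorem theorem1p1
  (g sigma rhop rhom hp hm : R)
  (Hg : 0 < g) (Hsigma : 0 < sigma)
  (Hrhop : 0 < rhop) (Hrhom : 0 < rhom)
  (Hhp : 0 < hp) (Hhm : 0 < hm)
  (l0 : nat) (Hl0 : (6 <= l0)%nat)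
  (Up Um : R -> R)
  (HUp : @class_C_on R_CompleteNormedModule (segment 0 hp) l0 Up)
  (HUm : @class_C_on R_CompleteNormedModule (segment (- hm) 0) l0 Um)
  (HdUp : forall x : R, segment 0 hp x -> dR (segment 0 hp) 1 Up x <> 0)
  (HdUm : forall x : R, segment (- hm) 0 x -> dR (segment (- hm) 0) 1 Um x <> 0)
  (a b : R)
  (Ha : is_minimum (velocity_range hp hm Up Um) a)
  (Hb : is_maximum (velocity_range hp hm Up Um) b)
  (k : R) (Hk : k <> 0)
  (Hstab : 0 <= - g * (rhop - rhom) + sigma * k ^ 2)
  (c : C) (Hc : 0 < Im c)
  (Hmode : exists (eta : C) (vp vm : R -> C),
      eta <> RtoC 0 /\
      interface_mode g sigma rhop rhom hp hm Up Um k c eta vp vm) :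
  (Re c - (a + b) / 2) ^ 2 + (Im c) ^ 2 <= ((b - a) / 2) ^ 2.
Proof.
  destruct Hmode as (eta & vp & vm & Heta & [Rp Rm Lp Lm Kp Km Dyn]).
  apply Rnot_lt_le. intros Hout.
  (* This is the negated conclusion with the squares expanded. *)
  assert (Hm : 0 < Re c ^ 2 + Im c ^ 2 - (a + b) * Re c + a * b) by nra.
  destruct Ha as [_ Ha], Hb as [_ Hb].
  assert (Hne : forall r : R, (r - c)%C <> 0%C).
  { intros r E. apply (f_equal Im) in E. simpl in E. unfold Im in Hc. lra. }
  (* The kinematic conditions say that F takes this same value [w] at the interface from both
     sides. *)
  set (w := (Ci * k * eta)%C) in *.
  assert (Hw : w <> 0%C).
  { unfold w. repeat apply Cmult_neq_0; try assumption.
    - intros E. apply (f_equal Im) in E. simpl in E. lra.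
    - intros E. apply (f_equal Re) in E. exact (Hk E). }
  (* The interface is the left end of the upper layer, where [vp] is nonzero, so the decay there is
     strict. For the lower layer the left end is the wall, where [vm] vanishes, and only the weak
     inequality is kept. *)
  destruct (rayleigh_flux_decay 0 hp Up k a b c vp l0) as [_ Sp];
    try assumption; [lia | apply HUp | |].
  { intros x Hx. split; [apply Ha | apply Hb]; right; exists x; auto. }
  destruct (rayleigh_flux_decay (- hm) 0 Um k a b c vm l0) as [Sm _];
    try assumption; [lra | lia | apply HUm | |].
  { intros x Hx. split; [apply Ha | apply Hb]; left; exists x; auto. }
  assert (Hvp : vp 0 <> 0%C) by (rewrite <- Kp; apply Cmult_neq_0; auto).
  specialize (Sp Hvp).
  assert (Ep : rayleigh_flux (segment 0 hp) Up c vp hp = 0%C).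
  { unfold rayleigh_flux. rewrite Lp. replace (RtoC 0 / (Up hp - c))%C with (RtoC 0) by (field; apply Hne).
    apply injective_projections; simpl; ring. }
  assert (Em : rayleigh_flux (segment (- hm) 0) Um c vm (- hm) = 0%C).
  { unfold rayleigh_flux. rewrite Lm. replace (RtoC 0 / (Um (- hm)%R - c))%C with (RtoC 0) by (field; apply Hne).
    apply injective_projections; simpl; ring. }
  rewrite Ep in Sp. rewrite Em in Sm.
  set (Zp := rayleigh_flux (segment 0 hp) Up c vp 0) in *.
  set (Zm := rayleigh_flux (segment (- hm) 0) Um c vm 0) in *.
  set (T := g * (rhop - rhom) - sigma * k ^ 2) in *.
  (* The dynamic condition, multiplied by the conjugate of [i k eta]. *)
  assert (J : (rhop * Zp - rhom * Zm = RtoC T * (w * Cconj w))%C).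
  { unfold Zp, Zm, rayleigh_flux. rewrite <- Kp, <- Km.
    replace (w * (Up 0%R - c) / (Up 0%R - c))%C with w by (field; apply Hne).
    replace (w * (Um 0%R - c) / (Um 0%R - c))%C with w by (field; apply Hne).
    rewrite <- Kp, <- Km in Dyn.
    replace (RtoC T * (w * Cconj w))%C with ((w * RtoC T) * Cconj w)%C by ring.
    rewrite Dyn. ring. }
  pose proof (f_equal Re J) as J1. pose proof (f_equal Im J) as J2.
  clearbody Zp Zm w. revert J1 J2 Sp Sm.
  generalize ((2 * Re c - a - b) / (2 * Im c)). intros s.
  destruct Zp as [p1 p2], Zm as [m1 m2], w as [w1 w2]. simpl.
  intros J1 J2 Sp Sm.
  assert (HT : T <= 0) by (unfold T; lra).
  assert (Q1 : rhop * p1 - rhom * m1 = T * (w1 * w1 + w2 * w2)) by lra.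
  assert (Q2 : rhop * p2 - rhom * m2 = 0) by lra.
  (* The jump of the weighted flux is real, so its s-multiple drops out and the sign of [T]
     decides. *)
  assert (rhop * (p1 - s * p2) - rhom * (m1 - s * m2) <= 0).
  { replace (rhop * (p1 - s * p2) - rhom * (m1 - s * m2))
      with (rhop * p1 - rhom * m1 - s * (rhop * p2 - rhom * m2)) by ring.
    rewrite Q1, Q2. nra. }
  assert (0 < rhop * (p1 - s * p2)) by (apply Rmult_lt_0_compat; lra).
  assert (rhom * (m1 - s * m2) <= 0) by nra.
  lra.
Qed.
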